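(* Let $\mathcal{G}: A_G=\bigoplus_{g\in G}A_g$ be a $G$-graded $\mathbb{F}$-algebra, where $\mathbb{F}$ is an algebraically closed field such that $H^2(G,\mathbb{F}^* )=1$. Then every simple $A_e$-module $M$ which is $\mathcal{G}$-invariant and satisfies $\dim_{\mathbb{F}}(M)<|\mathbb{F}|$ is restricted from an $A_G$-module.
   Context: Algebras are associative and unital; modules are left modules; $e$ is the identity of the group $G$. A $G$-graded $\mathbb{F}$-algebra is $A_G=\bigoplus_{g\in G}A_g$ with $A_gA_h\subseteq A_{gh}$. A $G$-graded left $A_G$-module is $W_G=\bigoplus_gW_g$ with $A_gW_h\subseteq W_{gh}$. $H^2(G,\mathbb{F}^* )$ is taken with trivial $G$-action on $\mathbb{F}^*$. For an $A_e$-module $M$, $A_G\overline{\otimes}_{A_e}M:=(A_G\otimes_{A_e}M)/t$, where $A_G\otimes_{A_e}M$ is graded by $(A_G\otimes_{A_e}M)_g=A_g\otimes_{A_e}M$ and $t$ is the largest graded submodule with zero $e$-component. The suspension $h(W_G)$ is the same module regraded by $h(W_G)_g:=W_{gh}$. $M$ is $\mathcal{G}$-invariant if for every $g\in G$ there is a degree-preserving isomorphism of $A_G$-modules $A_G\overline{\otimes}_{A_e}M\cong g(A_G\overline{\otimes}_{A_e}M)$. $M$ is restricted from an $A_G$-module $W$ if $M$ is the restriction of $W$ to $A_e$. $|\mathbb{F}|$ is the cardinality of $\mathbb{F}$. *)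

(* Defs.v *)
From HB Require Import structures.
From mathcomp Require Import all_boot all_order all_algebra.
From mathcomp Require Import boolp classical_sets cardinality.

Set Implicit Arguments.
Unset Strict Implicit.
Unset Printing Implicit Defensive.

Import GRing.Theory.
Local Open Scope ring_scope.
Local Open Scope quotient_scope.

(* V is the internal direct sum of the P i, i in a possibly infinite I. *)
Definition direct_sum (I : eqType) (V : zmodType) (P : I -> {pred V}) : Prop :=
  [/\ forall i, zmod_closed (P i),
      forall v, exists (s : seq I) (f : I -> V),
        [/\ uniq s, forall i, f i \in P i & v = \sum_(i <- s) f i]
    & forall (s : seq I) (f : I -> V), uniq s -> (forall i, f i \in P i) ->
        \sum_(i <- s) f i = 0 -> forall i, i \in s -> f i = 0].

Section DirectSum.
Variables (I : eqType) (V : zmodType) (P : I -> {pred V}).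

Lemma direct_sum_proj (phi : I -> V -> V) :
  (forall i, zmod_closed (P i)) ->
  (forall i, {morph phi i : x y / x - y}) ->
  (forall i j v, v \in P j -> phi i v = if i == j then v else 0) ->
  (forall v, exists2 t : seq (I * V),
     forall p, p \in t -> p.2 \in P p.1 & v = \sum_(p <- t) p.2) ->
  direct_sum P.
Proof.
move=> Pz phiB phiP gen.
have phi0 i : phi i 0 = 0 by have := phiB i 0 0; rewrite !subrr.
have phiD i : {morph phi i : x y / x + y}.
  move=> x y; have phiN z : phi i (- z) = - phi i z.
    by rewrite -[- z]add0r phiB phi0 add0r.
  by rewrite -{1}[y]opprK phiB phiN opprK.
have phisum i (J : eqType) (r : seq J) (h : J -> V) :
    phi i (\sum_(j <- r) h j) = \sum_(j <- r) phi i (h j).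
  by elim: r => [|j r IH]; rewrite ?big_nil ?phi0 // !big_cons phiD IH.
split=> // [v|s f us fP sf0 i si]; last first.
  have := congr1 (phi i) sf0; rewrite phisum phi0 => <-.
  rewrite (bigD1_seq i) //= (phiP _ i) // eqxx big1 ?addr0 // => j ji.
  by rewrite (phiP _ j) // eq_sym (negbTE ji).
have [t tP ->] := gen v.
have tsub q : q \in t -> uniq (undup (map fst t)) /\ q.1 \in undup (map fst t).
  by move=> qt; rewrite undup_uniq mem_undup map_f.
have zP i : 0 \in P i by case: (Pz i).
have dP i x y : x \in P i -> y \in P i -> x + y \in P i.
  case: (Pz i) => z0 zB xP yP; rewrite -[y]opprK zB // -[- y]add0r zB //.
exists (undup (map fst t)),
  (fun i => \sum_(p <- t) if i == p.1 then p.2 else 0).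
split; first exact: undup_uniq.
- move=> i; rewrite big_seq; elim/big_ind: _ => [||p pt];
    [exact: zP|exact: dP|].
  by case: eqP => [->|_]; [exact: tP | exact: zP].
- rewrite exchange_big /= big_seq [RHS]big_seq; apply: eq_bigr => q qt.
  have [u uq] := tsub _ qt.
  rewrite (bigD1_seq q.1) //= eqxx big1 ?addr0 // => j.
  by move=> /negbTE ->.
Qed.

Hypothesis D : direct_sum P.

Lemma hcomp_subproof v : exists c : seq I * (I -> V),
  [/\ uniq c.1, forall i, c.2 i \in P i & v = \sum_(i <- c.1) c.2 i].
Proof. by have [_ /(_ v)[s [f sf]] _] := D; exists (s, f). Qed.

(* The homogeneous component of v in P i. *)
Definition hcomp (i : I) (v : V) : V :=
  let c := sval (cid (hcomp_subproof v)) in if i \in c.1 then c.2 i else 0.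

Lemma piece0 i : 0 \in P i. Proof. by have [/(_ i)[]] := D. Qed.

Lemma pieceB i x y : x \in P i -> y \in P i -> x - y \in P i.
Proof. by have [/(_ i)[_ +] _ _] := D; apply. Qed.

Lemma pieceD i x y : x \in P i -> y \in P i -> x + y \in P i.
Proof.
by move=> xP yP; rewrite -[y]opprK pieceB // -[- y]add0r pieceB ?piece0.
Qed.

Lemma piece_sum i (J : eqType) (r : seq J) (h : J -> V) :
  (forall j, j \in r -> h j \in P i) -> \sum_(j <- r) h j \in P i.
Proof.
move=> hP; rewrite big_seq.
by elim/big_ind: _; [exact: piece0|exact: pieceD|exact: hP].
Qed.

Lemma hcomp_in i v : hcomp i v \in P i.
Proof.
rewrite /hcomp; case: cid => -[s f] /= [_ fP _].
by case: ifP => _ //; apply: piece0.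
Qed.

Lemma hcomp_supp v : exists2 s, uniq s & v = \sum_(i <- s) hcomp i v.
Proof.
rewrite /hcomp; case: cid => -[s f] /= [us fP vE]; exists s => //.
by rewrite {1}vE; apply: eq_big_seq => i ->.
Qed.

Lemma hcomp_uniq v (s : seq I) (f : I -> V) :
  uniq s -> (forall i, f i \in P i) -> v = \sum_(i <- s) f i ->
  forall i, hcomp i v = if i \in s then f i else 0.
Proof.
move=> us fP vE i; rewrite /hcomp; case: cid => -[t h] /= [ut hP vE'].
pose ff i := if i \in s then f i else 0.
pose hh i := if i \in t then h i else 0.
have restr (r1 r2 : seq I) (k : I -> V) : uniq r1 -> uniq r2 ->
    {subset r1 <= r2} ->
    \sum_(i <- r1) k i = \sum_(i <- r2) if i \in r1 then k i else 0.
  move=> u1 u2 sub; rewrite -big_mkcond /= -[RHS]big_filter.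
  apply: perm_big; apply: uniq_perm; rewrite ?filter_uniq // => j.
  by rewrite mem_filter; case: (boolP (j \in r1)) => // /sub ->.
pose u := undup (i :: s ++ t).
have uu : uniq u by exact: undup_uniq.
have : \sum_(i <- u) (hh i - ff i) = 0.
  rewrite sumrB -!restr //.
  - by rewrite -vE -vE' subrr.
  - by move=> j js; rewrite mem_undup inE mem_cat js orbT.
  - by move=> j jt; rewrite mem_undup inE mem_cat jt !orbT.
have [_ _ indep] := D.
move=> sum0; apply/eqP; rewrite -subr_eq0; apply/eqP.
apply: (indep u (fun i => hh i - ff i)) => // [j|].
  by apply: pieceB; rewrite /hh /ff; case: ifP => // _; apply: piece0.
by rewrite mem_undup inE eqxx.
Qed.

Lemma hcomp_hom i j v : v \in P j -> hcomp i v = if i == j then v else 0.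
Proof.
move=> vP; rewrite (@hcomp_uniq v [:: j] (fun k => if k == j then v else 0)) //.
- by rewrite inE; case: eqP.
- by move=> k; case: eqP => [->//|_]; exact: piece0.
- by rewrite big_seq1 eqxx.
Qed.

Lemma hcomp_span v : exists2 t : seq (I * V),
  forall p, p \in t -> p.2 \in P p.1 & v = \sum_(p <- t) p.2.
Proof.
have [s _ vE] := hcomp_supp v; exists [seq (i, hcomp i v) | i <- s].
  by move=> _ /mapP[i _ ->]; exact: hcomp_in.
by rewrite big_map.
Qed.

Lemma hcompB i : {morph hcomp i : x y / x - y}.
Proof.
move=> x y; have [s us xE] := hcomp_supp x; have [t ut yE] := hcomp_supp y.
pose u := undup (i :: s ++ t).
have ext (z : V) (r : seq I) : uniq r -> {subset r <= u} ->
    z = \sum_(i <- r) hcomp i z -> z = \sum_(i <- u) hcomp i z.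
  move=> ur sub zE; rewrite {1}zE.
  transitivity (\sum_(i <- u | i \in r) hcomp i z).
    rewrite -[RHS]big_filter; apply: perm_big; apply: uniq_perm => //.
      by rewrite filter_uniq ?undup_uniq.
    by move=> j; rewrite mem_filter; case: (boolP (j \in r)) => // /sub ->.
  rewrite big_mkcond; apply: eq_bigr => j _; case: ifP => // jr.
  by rewrite (hcomp_uniq ur (fun k => hcomp_in k z) zE) jr.
rewrite (@hcomp_uniq (x - y) u (fun k => hcomp k x - hcomp k y)).
- by rewrite mem_undup inE eqxx.
- exact: undup_uniq.
- by move=> k; apply: pieceB; exact: hcomp_in.
- rewrite sumrB; congr (_ - _); [apply: ext us _ xE | apply: ext ut _ yE].
  + by move=> j js; rewrite mem_undup inE mem_cat js !orbT.
  + by move=> j js; rewrite mem_undup inE mem_cat js !orbT.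
Qed.

Lemma hcompD i : {morph hcomp i : x y / x + y}.
Proof.
have c0 : hcomp i 0 = 0 by have := hcompB i 0 0; rewrite !subrr.
move=> x y; rewrite -{1}[y]opprK hcompB -[- y]add0r hcompB c0 add0r.
by rewrite opprK.
Qed.

End DirectSum.

Record grading (F : fieldType) (G : groupType) (A : algType F) := Grading {
  apiece :> G -> {pred A};
  apiece_submod : forall g, submod_closed (apiece g);
  apiece_direct : direct_sum apiece;
  apieceM : forall g h a b,
    a \in apiece g -> b \in apiece h -> a * b \in apiece (g * h)%g
}.

Section IdentityComponent.
Variables (F : fieldType) (G : groupType) (A : algType F) (Gr : grading G A).

Lemma apiece1 : 1 \in Gr 1%g.
Proof.
set D := apiece_direct Gr; set e := hcomp D 1%g 1.
suff -> : 1 = e by exact: hcomp_in.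
have rid h b : b \in Gr h -> b * e = b.
  move=> bh; have [s us sE] := hcomp_supp D 1.
  have bE : b = \sum_(i <- map (fun i => h * i)%g s)
                  b * hcomp D (h^-1 * i)%g 1.
    rewrite big_map -{1}[b]mulr1 {1}sE mulr_sumr.
    by apply: eq_bigr => i _; rewrite mulKg.
  have us' : uniq (map (fun i => h * i)%g s).
    by rewrite map_inj_uniq // => x y /mulgI.
  have cP i : b * hcomp D (h^-1 * i)%g 1 \in Gr i.
    by rewrite -{2}[i](mulVKg h); apply: apieceM => //; exact: hcomp_in.
  have := hcomp_uniq D us' cP bE h.
  rewrite (hcomp_hom D h bh) eqxx mulVg -/e => bif; rewrite [RHS]bif.
  case: ifP => // /negbT hs.
  have := hcomp_uniq D us (fun k => hcomp_in D k 1) sE 1%g.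
  case: ifP => [s1 _|_]; last by rewrite -/e => ->; rewrite mulr0.
  by case/negP: hs; apply/mapP; exists 1%g; rewrite ?mulg1.
have [s _ sE] := hcomp_supp D 1.
rewrite -[RHS]mul1r {1 2}sE mulr_suml; apply: eq_bigr => i _.
by rewrite (rid i) //; exact: hcomp_in.
Qed.

Lemma identity_subalg : GRing.subsemialg_closed (Gr 1%g).
Proof.
have S := apiece_submod Gr 1%g.
split; [exact: apiece1|split|..].
- by case: S.
- by move=> u v uS vS; case: S => _ /(_ 1 u v); rewrite scale1r; apply.
- by move=> a v vS; case: S => S0 /(_ a v 0); rewrite addr0; apply.
- by move=> u v uS vS; rewrite -[1%g]mulg1; exact: apieceM.
Qed.

Definition idcomp : Type := {a : A | a \in Gr 1%g}.

HB.instance Definition _ := [isSub of idcomp for @sval A _].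
HB.instance Definition _ := [Choice of idcomp by <:].
HB.instance Definition _ :=
  GRing.SubChoice_isSubAlgebra.Build F A _ idcomp identity_subalg.

End IdentityComponent.

Section Restriction.
Variables (R S : pzRingType) (f : {rmorphism R -> S}) (V : lmodType S).

Definition restriction of {rmorphism R -> S} : Type := V.

Local Notation W := (restriction f).

HB.instance Definition _ := GRing.Zmodule.on W.

Definition restriction_scale (a : R) (v : W) : W := f a *: (v : V).

Lemma restriction_scaleA a b v :
  restriction_scale a (restriction_scale b v) = restriction_scale (a * b) v.
Proof. by rewrite /restriction_scale scalerA rmorphM. Qed.

Lemma restriction_scale1 : left_id 1 restriction_scale.
Proof. by move=> v; rewrite /restriction_scale rmorph1 scale1r. Qed.

Lemma restriction_scaleDr : right_distributive restriction_scale +%R.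
Proof. by move=> a u v; rewrite /restriction_scale scalerDr. Qed.

Lemma restriction_scaleDl v : {morph restriction_scale^~ v : a b / a + b}.
Proof. by move=> a b; rewrite /restriction_scale rmorphD scalerDl. Qed.

HB.instance Definition _ := GRing.Zmodule_isLmodule.Build R W
  restriction_scaleA restriction_scale1 restriction_scaleDr restriction_scaleDl.

End Restriction.

Section QuotientModule.
Variables (R : pzRingType) (V : lmodType R).
Variables (N : {pred V}) (subN : submod_closed N).

Definition quot_pred of submod_closed N : {pred V} := N.

HB.instance Definition _ := GRing.isZmodClosed.Build V (quot_pred subN)
  (GRing.submod_closedB subN).

Definition quotmod : Type := Quotient.quot (quot_pred subN).

HB.instance Definition _ := GRing.Zmodule.on quotmod.

Definition qproj (v : V) : quotmod := \pi_(Quotient.quot (quot_pred subN)) v.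
Definition qrepr (x : quotmod) : V := repr (x : Quotient.quot (quot_pred subN)).

Lemma qprojP u v : reflect (qproj u = qproj v) (u - v \in N).
Proof.
have -> : (u - v \in N) = (u - v \in quot_pred subN) by [].
by rewrite Quotient.idealrBE; apply: eqP.
Qed.

Lemma qreprK : cancel qrepr qproj.
Proof. by move=> x; rewrite /qproj /qrepr reprK. Qed.

Lemma qprojB : {morph qproj : u v / u - v}.
Proof. by move=> u v; rewrite /qproj raddfB. Qed.

Lemma qprojD : {morph qproj : u v / u + v}.
Proof. by move=> u v; rewrite /qproj raddfD. Qed.

Lemma qproj0 : qproj 0 = 0.
Proof. by rewrite /qproj raddf0. Qed.

Lemma qproj_sum (I : Type) (r : seq I) (h : I -> V) :
  qproj (\sum_(i <- r) h i) = \sum_(i <- r) qproj (h i).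
Proof. exact: (big_morph _ qprojD qproj0). Qed.

Definition quot_scale (a : R) (x : quotmod) : quotmod := qproj (a *: qrepr x).

Lemma quot_scaleE a v : quot_scale a (qproj v) = qproj (a *: v).
Proof.
apply/qprojP; rewrite -scalerBr -[_ *: _]addr0; case: (subN) => N0; apply=> //.
by apply/qprojP; exact: qreprK.
Qed.

Lemma quot_scaleA a b x : quot_scale a (quot_scale b x) = quot_scale (a * b) x.
Proof. by rewrite -[x]qreprK !quot_scaleE scalerA. Qed.

Lemma quot_scale1 : left_id 1 quot_scale.
Proof. by move=> x; rewrite -[x]qreprK !quot_scaleE scale1r. Qed.

Lemma quot_scaleDr : right_distributive quot_scale +%R.
Proof.
move=> a x y; rewrite -[x]qreprK -[y]qreprK -qprojD !quot_scaleE.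
by rewrite scalerDr qprojD.
Qed.

Lemma quot_scaleDl x : {morph quot_scale^~ x : a b / a + b}.
Proof.
by move=> a b; rewrite -[x]qreprK !quot_scaleE scalerDl qprojD.
Qed.

HB.instance Definition _ := GRing.Zmodule_isLmodule.Build R quotmod
  quot_scaleA quot_scale1 quot_scaleDr quot_scaleDl.

Lemma qprojZ a v : qproj (a *: v) = a *: qproj v.
Proof. by rewrite -quot_scaleE. Qed.

End QuotientModule.

(* The extension of scalars A (x)_R M along f : R -> A: formal sums of pairs  *)
(* modulo the congruence generated by the tensor relations.  No formal        *)
(* negatives are needed, since (- a, m) is an opposite of (a, m).             *)
Section Tensor.
Variables (R A : pzRingType) (f : {rmorphism R -> A}) (M : lmodType R).

Inductive tensor_eq : seq (A * M) -> seq (A * M) -> Prop :=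
| TensorRefl s : tensor_eq s s
| TensorSym s t : tensor_eq s t -> tensor_eq t s
| TensorTrans s t u : tensor_eq s t -> tensor_eq t u -> tensor_eq s u
| TensorCat s s' t t' :
    tensor_eq s s' -> tensor_eq t t' -> tensor_eq (s ++ t) (s' ++ t')
| TensorCatC s t : tensor_eq (s ++ t) (t ++ s)
| TensorZero m : tensor_eq [:: (0, m)] [::]
| TensorAddl a b m : tensor_eq [:: (a + b, m)] [:: (a, m); (b, m)]
| TensorAddr a m n : tensor_eq [:: (a, m + n)] [:: (a, m); (a, n)]
| TensorBal a r m : tensor_eq [:: (a * f r, m)] [:: (a, r *: m)].

Definition tensor_rel : rel (seq (A * M)) := fun s t => `[< tensor_eq s t >].

Lemma tensor_rel_refl : reflexive tensor_rel.
Proof. by move=> s; apply/asboolP; exact: TensorRefl. Qed.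

Lemma tensor_rel_sym : symmetric tensor_rel.
Proof. by move=> s t; apply: asbool_equiv_eq; split; exact: TensorSym. Qed.

Lemma tensor_rel_trans : transitive tensor_rel.
Proof.
by move=> t s u /asboolP st /asboolP tu; apply/asboolP; exact: TensorTrans tu.
Qed.

Canonical tensor_equiv :=
  EquivRel tensor_rel tensor_rel_refl tensor_rel_sym tensor_rel_trans.

Definition tensor : Type := {eq_quot tensor_rel}.

HB.instance Definition _ := Choice.on tensor.

Definition tclass (s : seq (A * M)) : tensor := \pi_({eq_quot tensor_rel}) s.
Definition tpairs (x : tensor) : seq (A * M) :=
  repr (x : {eq_quot tensor_rel}).

Lemma tclassP s t : tclass s = tclass t <-> tensor_eq s t.
Proof.
split=> [/eqP|st]; first by rewrite /tclass eqmodE => /asboolP.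
by apply/eqP; rewrite /tclass eqmodE; apply/asboolP.
Qed.

Lemma tpairsK : cancel tpairs tclass.
Proof. by move=> x; rewrite /tclass /tpairs reprK. Qed.

Lemma tpairs_eq s : tensor_eq (tpairs (tclass s)) s.
Proof. by apply/tclassP; rewrite tpairsK. Qed.

Definition tensor_add (x y : tensor) : tensor := tclass (tpairs x ++ tpairs y).
Definition tensor_opp (x : tensor) : tensor :=
  tclass [seq (- p.1, p.2) | p <- tpairs x].
Definition tensor_scale (c : A) (x : tensor) : tensor :=
  tclass [seq (c * p.1, p.2) | p <- tpairs x].

Lemma tensor_addE s t : tensor_add (tclass s) (tclass t) = tclass (s ++ t).
Proof. by apply/tclassP; apply: TensorCat; exact: tpairs_eq. Qed.

Lemma tensor_addA : associative tensor_add.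
Proof.
move=> x y z; rewrite -[x]tpairsK -[y]tpairsK -[z]tpairsK.
by rewrite !tensor_addE catA.
Qed.

Lemma tensor_addC : commutative tensor_add.
Proof.
move=> x y; rewrite -[x]tpairsK -[y]tpairsK !tensor_addE.
by apply/tclassP; exact: TensorCatC.
Qed.

Lemma tensor_add0 : left_id (tclass [::]) tensor_add.
Proof. by move=> x; rewrite -[x]tpairsK tensor_addE. Qed.

Lemma tensor_eq_opp s :
  tensor_eq ([seq (- p.1, p.2) | p <- s] ++ s) [::].
Proof.
elim: s => [|[a m] s IH] /=; first exact: TensorRefl.
set t := [seq _ | p <- s] in IH *.
have e1 : tensor_eq ((- a, m) :: t ++ (a, m) :: s)
                    ([:: (- a, m); (a, m)] ++ (t ++ s)).
  rewrite -[_ :: _ ++ _]/([:: (- a, m)] ++ (t ++ [:: (a, m)] ++ s)).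
  rewrite -[[:: _; _]]/([:: (- a, m)] ++ [:: (a, m)]) -!catA.
  apply: TensorCat; first exact: TensorRefl.
  rewrite !catA; apply: TensorCat; last exact: TensorRefl.
  exact: TensorCatC.
apply: TensorTrans e1 _; rewrite -[[::]]/([::] ++ [::]).
apply: TensorCat IH; apply: TensorTrans (TensorZero m).
by apply: TensorSym; rewrite -[X in (X, m)](addNr a); exact: TensorAddl.
Qed.

Lemma tensor_addN : left_inverse (tclass [::]) tensor_opp tensor_add.
Proof.
move=> x; rewrite /tensor_opp -{2}[x]tpairsK tensor_addE.
by apply/tclassP; exact: tensor_eq_opp.
Qed.

HB.instance Definition _ := GRing.isZmodule.Build tensor
  tensor_addA tensor_addC tensor_add0 tensor_addN.

Lemma tclass_cat s t : tclass (s ++ t) = tclass s + tclass t.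
Proof. by rewrite -tensor_addE. Qed.

Lemma tensor_eq_scale c s t : tensor_eq s t ->
  tensor_eq [seq (c * p.1, p.2) | p <- s] [seq (c * p.1, p.2) | p <- t].
Proof.
elim=> {s t}
  [s|s t _|s t u _ st _ tu|s s' t t' _ ss _ tt|s t|m|a b m|a m n|a r m].
- exact: TensorRefl.
- exact: TensorSym.
- exact: TensorTrans tu.
- by rewrite !map_cat; exact: TensorCat.
- by rewrite !map_cat; exact: TensorCatC.
- by rewrite /= mulr0; exact: TensorZero.
- by rewrite /= mulrDr; exact: TensorAddl.
- exact: TensorAddr.
- by rewrite /= mulrA; exact: TensorBal.
Qed.

Lemma tensor_scaleE c s :
  tensor_scale c (tclass s) = tclass [seq (c * p.1, p.2) | p <- s].
Proof. by apply/tclassP; apply: tensor_eq_scale; exact: tpairs_eq. Qed.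

Lemma tensor_scaleA a b x :
  tensor_scale a (tensor_scale b x) = tensor_scale (a * b) x.
Proof.
rewrite -[x]tpairsK !tensor_scaleE -map_comp; congr tclass.
by apply: eq_map => p /=; rewrite mulrA.
Qed.

Lemma tensor_scale1 : left_id 1 tensor_scale.
Proof.
move=> x; rewrite -[x]tpairsK tensor_scaleE; congr tclass.
by rewrite -[RHS]map_id; apply: eq_map => -[a m] /=; rewrite mul1r.
Qed.

Lemma tensor_scaleDr : right_distributive tensor_scale +%R.
Proof.
move=> c x y; rewrite -[x]tpairsK -[y]tpairsK -tclass_cat !tensor_scaleE.
by rewrite map_cat tclass_cat.
Qed.

Lemma tensor_scaleDl x : {morph tensor_scale^~ x : a b / a + b}.
Proof.
move=> a b; rewrite -[x]tpairsK !tensor_scaleE.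
elim: (tpairs x) => [|[c m] s IH]; first by rewrite -tclass_cat.
rewrite !map_cons -cat1s tclass_cat IH.
rewrite -[in RHS]cat1s tclass_cat -[(b * _, _) :: _]cat1s tclass_cat.
rewrite [RHS]addrACA; congr (_ + _); rewrite -tclass_cat /= mulrDl.
by apply/tclassP; exact: TensorAddl.
Qed.

HB.instance Definition _ := GRing.Zmodule_isLmodule.Build A tensor
  tensor_scaleA tensor_scale1 tensor_scaleDr tensor_scaleDl.

Definition tens (a : A) (m : M) : tensor := tclass [:: (a, m)].

Lemma tensE x : x = \sum_(p <- tpairs x) tens p.1 p.2.
Proof.
rewrite -{1}[x]tpairsK; elim: (tpairs x) => [|[a m] s IH].
  by rewrite big_nil.
by rewrite big_cons -IH -cat1s tclass_cat.
Qed.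

Lemma tens0l m : tens 0 m = 0.
Proof. by apply/tclassP; exact: TensorZero. Qed.

Lemma tensDl a b m : tens (a + b) m = tens a m + tens b m.
Proof. by rewrite -tclass_cat; apply/tclassP; exact: TensorAddl. Qed.

Lemma tensDr a m n : tens a (m + n) = tens a m + tens a n.
Proof. by rewrite -tclass_cat; apply/tclassP; exact: TensorAddr. Qed.

Lemma tens_bal a r m : tens (a * f r) m = tens a (r *: m).
Proof. by apply/tclassP; exact: TensorBal. Qed.

Lemma tensZ c a m : c *: tens a m = tens (c * a) m.
Proof. by rewrite -[LHS]/(tensor_scale _ _) tensor_scaleE. Qed.

Section UniversalProperty.
Variables (V : zmodType) (h : A -> M -> V).
Hypothesis hDl : forall a b m, h (a + b) m = h a m + h b m.
Hypothesis hDr : forall a m n, h a (m + n) = h a m + h a n.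
Hypothesis h_bal : forall a r m, h (a * f r) m = h a (r *: m).

Definition tensor_lift (x : tensor) : V := \sum_(p <- tpairs x) h p.1 p.2.

Lemma tensor_lift_eq s t : tensor_eq s t ->
  \sum_(p <- s) h p.1 p.2 = \sum_(p <- t) h p.1 p.2.
Proof.
elim=> {s t}
  [s|s t _|s t u _ -> _ ->|s s' t t' _ ss _ tt|s t|m|a b m|a m n|a r m] //.
- by rewrite !big_cat /= ss tt.
- by rewrite !big_cat /= addrC.
- rewrite big_seq1 big_nil /=; apply: (addrI (h 0 m)).
  by rewrite -hDl !addr0.
- by rewrite !big_cons !big_nil /= !addr0 hDl.
- by rewrite !big_cons !big_nil /= !addr0 hDr.
- by rewrite !big_seq1 /= h_bal.
Qed.

Lemma tensor_liftE s : tensor_lift (tclass s) = \sum_(p <- s) h p.1 p.2.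
Proof. exact/tensor_lift_eq/tpairs_eq. Qed.

Lemma tensor_lift_tens a m : tensor_lift (tens a m) = h a m.
Proof. by rewrite /tens tensor_liftE big_seq1. Qed.

Lemma tensor_liftD : {morph tensor_lift : x y / x + y}.
Proof.
move=> x y; rewrite -[x]tpairsK -[y]tpairsK -tclass_cat !tensor_liftE.
by rewrite big_cat.
Qed.

Lemma tensor_liftB : {morph tensor_lift : x y / x - y}.
Proof.
move=> x y; apply/eqP; rewrite eq_sym subr_eq; apply/eqP.
by rewrite -tensor_liftD subrK.
Qed.

End UniversalProperty.

End Tensor.

Section GradedModules.
Variables (F : fieldType) (G : groupType) (A : algType F) (Gr : grading G A).

Record gradedMod := GradedMod {
  gmod :> lmodType A;
  gpiece : G -> {pred gmod};
  gpiece_direct : direct_sum gpiece;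
  gpieceZ : forall g h a w,
    a \in Gr g -> w \in gpiece h -> a *: w \in gpiece (g * h)%g
}.

Arguments gpiece : clear implicits.

Definition graded_iso (W W' : gradedMod) : Prop :=
  exists f : {linear W -> W'}, bijective f /\
    forall g w, w \in gpiece W g -> f w \in gpiece W' g.

Section Suspension.
Variables (h : G) (W : gradedMod).

Definition susp_piece (g : G) : {pred W} := gpiece W (g * h)%g.

Lemma susp_direct : direct_sum susp_piece.
Proof.
have D := gpiece_direct W.
apply: (@direct_sum_proj _ _ _ (fun g => hcomp D (g * h)%g)).
- by move=> g; case: D => zD _ _; exact: zD.
- by move=> g; exact: hcompB.
- by move=> g k v vP; rewrite (hcomp_hom D _ vP) (inj_eq (mulIg h)).
- move=> v; have [t tP vE] := hcomp_span D v.
  exists [seq ((p.1 * h^-1)%g, p.2) | p <- t]; last by rewrite big_map.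
  by move=> _ /mapP[p pt ->]; rewrite /susp_piece /= mulgVK; exact: tP.
Qed.

Lemma suspZ g k a w :
  a \in Gr g -> w \in susp_piece k -> a *: w \in susp_piece (g * k)%g.
Proof. by rewrite /susp_piece -mulgA; exact: gpieceZ. Qed.

Definition suspension : gradedMod := GradedMod susp_direct suspZ.

End Suspension.

Definition graded_submod (W : gradedMod) (N : {pred W}) : Prop :=
  submod_closed N /\
  forall w, w \in N -> exists (s : seq G) (f : G -> W),
    [/\ uniq s, forall g, f g \in gpiece W g, forall g, f g \in N
      & w = \sum_(g <- s) f g].

Lemma graded_submodP (W : gradedMod) (N : {pred W}) :
  graded_submod N <-> submod_closed N /\
  forall g w, w \in N -> hcomp (gpiece_direct W) g w \in N.
Proof.
split=> -[Ns NP]; split=> //.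
  move=> g w /NP[s [f [us fP fN wE]]].
  rewrite (hcomp_uniq (gpiece_direct W) us fP wE); case: ifP => // _.
  by case: Ns.
move=> w wN; have [s us wE] := hcomp_supp (gpiece_direct W) w.
exists s, (fun g => hcomp (gpiece_direct W) g w).
by split=> // g; [exact: hcomp_in | exact: NP].
Qed.

Section GradedQuotient.
Variables (W : gradedMod) (N : {pred W}) (Ngr : graded_submod N).

Let subN : submod_closed N := proj1 Ngr.

Definition quot_piece (g : G) : {pred quotmod subN} :=
  [pred x | `[< exists2 w, w \in gpiece W g & x = qproj subN w >]].

Lemma quot_direct : direct_sum quot_piece.
Proof.
pose D := gpiece_direct W.
have cN g w : w \in N -> hcomp D g w \in N.
  by case/graded_submodP: Ngr => _; apply.
have cE g w :
    qproj subN (hcomp D g (qrepr (qproj subN w))) = qproj subN (hcomp D g w).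
  by apply/qprojP; rewrite -hcompB cN //; apply/qprojP; exact: qreprK.
apply: (@direct_sum_proj _ _ _ (fun g x => qproj subN (hcomp D g (qrepr x)))).
- move=> g; split.
    by apply/asboolP; exists 0; rewrite ?qproj0 // (piece0 D).
  move=> _ _ /asboolP[u uP ->] /asboolP[v vP ->]; apply/asboolP.
  by exists (u - v); rewrite ?qprojB // (pieceB D).
- move=> g x y; rewrite -[x]qreprK -[y]qreprK -qprojB !cE.
  by rewrite hcompB qprojB.
- move=> g k _ /asboolP[w wP ->]; rewrite cE (hcomp_hom D _ wP).
  by case: ifP; rewrite ?qproj0.
- move=> x; have [t tP xE] := hcomp_span D (qrepr x).
  exists [seq (p.1, qproj subN p.2) | p <- t].
    move=> _ /mapP[p pt ->]; apply/asboolP; exists p.2 => //; exact: tP.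
  by rewrite big_map -qproj_sum -xE qreprK.
Qed.

Lemma quotZ g h a x :
  a \in Gr g -> x \in quot_piece h -> a *: x \in quot_piece (g * h)%g.
Proof.
move=> aP /asboolP[w wP ->]; apply/asboolP.
by exists (a *: w); rewrite ?qprojZ //; exact: gpieceZ.
Qed.

Definition graded_quot : gradedMod := GradedMod quot_direct quotZ.

End GradedQuotient.

(* The union of the graded submodules with zero e-component; the next lemmas  *)
(* show that it is itself such a submodule, hence the largest one.            *)
Section Radical.
Variable W : gradedMod.

Definition zero_e (N : {pred W}) : Prop :=
  {in N, forall w, w \in gpiece W 1%g -> w = 0}.

Definition radical : {pred W} :=
  [pred w | `[< exists N : {pred W},
                  [/\ graded_submod N, zero_e N & w \in N] >]].

Lemma radical_max (N : {pred W}) :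
  graded_submod N -> zero_e N -> {subset N <= radical}.
Proof. by move=> Ngr Ne w wN; apply/asboolP; exists N. Qed.

Lemma radical_zero_e : zero_e radical.
Proof. by move=> w /asboolP[N [_ Ne wN]]; exact: Ne. Qed.

Lemma radical_add u v : u \in radical -> v \in radical -> u + v \in radical.
Proof.
set D := gpiece_direct W.
case/asboolP=> N [/graded_submodP[[N0 Ns] Nc] Ne uN].
case/asboolP=> N' [/graded_submodP[[N'0 N's] N'c] N'e vN].
pose S : {pred W} :=
  [pred w | `[< exists x y, [/\ x \in N, y \in N' & w = x + y] >]].
apply/asboolP; exists S.
split; last by apply/asboolP; exists u, v.
- apply/graded_submodP; split; first split.
  + by apply/asboolP; exists 0, 0; rewrite addr0.
  + move=> a _ _ /asboolP[x [y [xN yN ->]]] /asboolP[x' [y' [x'N y'N ->]]].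
    apply/asboolP; exists (a *: x + x'), (a *: y + y').
    by rewrite Ns ?N's // scalerDr addrACA.
  + move=> g _ /asboolP[x [y [xN yN ->]]]; apply/asboolP.
    by exists (hcomp D g x), (hcomp D g y); rewrite hcompD Nc ?N'c.
- move=> _ /asboolP[x [y [xN yN ->]]] xyP.
  have := hcomp_hom D 1%g xyP; rewrite eqxx hcompD => <-.
  have -> : hcomp D 1%g x = 0 by apply: Ne (Nc _ _ xN) _; exact: hcomp_in.
  have -> : hcomp D 1%g y = 0 by apply: N'e (N'c _ _ yN) _; exact: hcomp_in.
  exact: addr0.
Qed.

Lemma radical_submod : submod_closed radical.
Proof.
split.
  pose Z : {pred W} := pred1 0.
  apply/asboolP; exists Z; split; rewrite ?inE //.
    split; first split; rewrite ?inE //.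
      by move=> a _ _ /eqP-> /eqP->; rewrite inE scaler0 addr0.
    move=> _ /eqP->; exists [::], (fun=> 0).
    split; rewrite ?big_nil // => g; rewrite ?inE //.
    by rewrite (piece0 (gpiece_direct W)).
  by move=> w /eqP.
move=> a u v uR vR; apply: radical_add => //.
case/asboolP: uR => N [Ngr Ne uN]; apply/asboolP; exists N; split=> //.
by case: Ngr => -[N0 Ns] _; rewrite -[_ *: _]addr0 Ns.
Qed.

Lemma radical_graded : graded_submod radical.
Proof.
apply/graded_submodP; split; first exact: radical_submod.
move=> g w /asboolP[N [Ngr Ne wN]]; apply/asboolP; exists N; split=> //.
by case/graded_submodP: Ngr => _; apply.
Qed.

End Radical.

Section InducedModule.
Variable M : lmodType (idcomp Gr).

Definition idincl : {rmorphism idcomp Gr -> A} := \val.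

Definition tensor_piece (g : G) : {pred tensor idincl M} :=
  [pred x | `[< exists2 s : seq (A * M),
      forall p, p \in s -> p.1 \in Gr g
    & x = \sum_(p <- s) tens idincl p.1 p.2 >]].

Lemma tensor_direct : direct_sum tensor_piece.
Proof.
pose D := apiece_direct Gr.
pose h g a m := tens idincl (M := M) (hcomp D g a) m.
have cM g a (r : idcomp Gr) : hcomp D g (a * val r) = hcomp D g a * val r.
  have [s us aE] := hcomp_supp D a.
  have arE : a * val r = \sum_(k <- s) hcomp D k a * val r.
    by rewrite {1}aE mulr_suml.
  have arP k : hcomp D k a * val r \in Gr k.
    by have := apieceM (hcomp_in D k a) (valP r); rewrite mulg1.
  rewrite (hcomp_uniq D us arP arE); case: ifP => // /negbT ks.
  have := hcomp_uniq D us (fun k => hcomp_in D k a) aE g.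
  by rewrite (negbTE ks) => ->; rewrite mul0r.
have hDl g a b m : h g (a + b) m = h g a m + h g b m.
  by rewrite /h hcompD tensDl.
have hDr g a m n : h g a (m + n) = h g a m + h g a n by rewrite /h tensDr.
have hb g a r m : h g (a * idincl r) m = h g a (r *: m).
  by rewrite /h cM -tens_bal.
have phit g := tensor_lift_tens (hDl g) (hDr g) (hb g).
have phiB g := tensor_liftB (hDl g) (hDr g) (hb g).
have phiD g := tensor_liftD (hDl g) (hDr g) (hb g).
pose phi g : tensor idincl M -> tensor idincl M := tensor_lift (h g).
have phi0 g : phi g 0 = 0 by have := phiB g 0 0; rewrite !subrr.
apply: (@direct_sum_proj _ _ _ phi) => //.
- move=> g; split.
    apply/asboolP; exists [::]; last by rewrite big_nil.
    by move=> p; rewrite in_nil.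
  move=> _ _ /asboolP[s sP ->] /asboolP[t tP ->]; apply/asboolP.
  exists (s ++ [seq (- p.1, p.2) | p <- t]).
    move=> p; rewrite mem_cat => /orP[/sP//|/mapP[q /tP qP ->] /=].
    by rewrite -[- _]add0r (pieceB D) // (piece0 D).
  rewrite big_cat big_map /=; congr (_ + _); rewrite -sumrN.
  apply: eq_bigr => p _; apply/eqP; rewrite eq_sym -addr_eq0 -tensDl.
  by rewrite addNr tens0l.
- move=> g k _ /asboolP[s sP ->].
  rewrite (big_morph (phi g) (phiD g) (phi0 g)) big_seq.
  under eq_bigr => p pP do rewrite /phi phit /h (hcomp_hom D _ (sP _ pP)).
  case: eqP => _; first by rewrite -big_seq.
  by rewrite big1 // => p _; rewrite tens0l.
- move=> x; rewrite [x]tensE; elim: (tpairs x) => [|[a m] s [t tP tE]].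
    by exists [::]; [move=> p; rewrite in_nil|rewrite !big_nil].
  have [u uP aE] := hcomp_span D a.
  exists ([seq (p.1, tens idincl p.2 m) | p <- u] ++ t).
    move=> p; rewrite mem_cat => /orP[/mapP[q /uP qP ->]|/tP//].
    apply/asboolP; exists [:: (q.2, m)]; last by rewrite big_seq1.
    by move=> r; rewrite inE => /eqP->.
  rewrite big_cons big_cat big_map /= -tE; congr (_ + _).
  rewrite aE; apply: (big_morph (fun a => tens idincl a m)) => [b c|].
    exact: tensDl.
  exact: tens0l.
Qed.

Lemma tensor_pieceZ g h a x :
  a \in Gr g -> x \in tensor_piece h -> a *: x \in tensor_piece (g * h)%g.
Proof.
move=> aP /asboolP[s sP ->]; apply/asboolP.
exists [seq (a * p.1, p.2) | p <- s].
  by move=> _ /mapP[p /sP pP ->]; exact: apieceM.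
rewrite big_map scaler_sumr; apply: eq_bigr => p _; exact: tensZ.
Qed.

Definition graded_tensor : gradedMod := GradedMod tensor_direct tensor_pieceZ.

(* The quotient of A (x)_(A_e) M by its largest graded submodule with zero   *)
(* e-component.                                                               *)
Definition reduced_tensor : gradedMod :=
  graded_quot (radical_graded graded_tensor).

Definition graded_invariant : Prop :=
  forall g : G, graded_iso reduced_tensor (suspension g reduced_tensor).

(* Equality with a restriction is read up to isomorphism of A_e-modules. *)
Definition restricted_from_alg : Prop :=
  exists (W : lmodType A) (f : {linear M -> restriction W idincl}), bijective f.

End InducedModule.
End GradedModules.

Arguments gpiece {F G A Gr} _ _%_group_scope _.

Definition simple_module (R : pzRingType) (M : lmodType R) : Prop :=
  (exists m : M, m <> 0) /\
  forall N : {pred M}, submod_closed N -> N =i pred1 0 \/ N =i predT.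

Definition is_basis (F : fieldType) (V : lmodType F) (B : set V) : Prop :=
  (forall (s : seq V) (c : V -> F), uniq s -> {subset s <= B} ->
     \sum_(v <- s) c v *: v = 0 -> forall v, v \in s -> c v = 0) /\
  (forall v, exists (s : seq V) (c : V -> F),
     {subset s <= B} /\ v = \sum_(b <- s) c b *: b).

Definition card_lt (T U : Type) (A : set T) (B : set U) : Prop :=
  (A #<= B)%card /\ ~ (B #<= A)%card.

(* The dimension does not depend on the basis, so one basis decides. *)
Definition dim_lt_card (F : fieldType) (V : lmodType F) : Prop :=
  exists2 B : set V, is_basis B & card_lt B [set: F].

Definition cocycle2 (G : groupType) (F : fieldType) (a : G -> G -> F) : Prop :=
  (forall g h, a g h != 0) /\
  (forall g h k, a g h * a (g * h)%g k = a g (h * k)%g * a h k).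

Definition coboundary2 (G : groupType) (F : fieldType) (a : G -> G -> F) :
    Prop :=
  exists2 l : G -> F, forall g, l g != 0 &
    forall g h, a g h = l g * l h / l (g * h)%g.

Definition H2_trivial (G : groupType) (F : fieldType) : Prop :=
  forall a : G -> G -> F, cocycle2 a -> coboundary2 a.

Definition underlying_vect (F : fieldType) (R : algType F) (M : lmodType R) :
    lmodType F :=
  restriction M (GRing.in_alg R).

(* Main.v *)
Require Import Defs.
From HB Require Import structures.
From mathcomp Require Import all_boot all_order all_algebra.
From mathcomp Require Import boolp classical_sets cardinality wochoice.

(** Write W for the reduced tensor product of A and M over A_e.  Its identity
    component W_e is a copy of M, and it generates W over A.

    Since dim M < |F|, Schur's lemma holds in its strongest form: every
    A_e-endomorphism of M is a scalar ([schur_scalar]).  Indeed, if th is an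
    endomorphism that is not a scalar, then every th - c is invertible, and for
    a fixed m <> 0 the |F| vectors (th - c)^-1 m are linearly independent
    ([resolvent_independent]): M is torsion-free over F[X], X acting as th, so
    a linear relation between them would be a relation between the rational
    functions 1 / (X - c).  That an independent family is no larger than a
    basis, in any dimension, is [independent_inj_spanning].

    An endomorphism of W that preserves degrees is determined by its restriction
    to W_e, so it is a scalar too.  Hence the isomorphism f_g of W onto its
    suspension by g, which multiplies degrees by g on the right, is unique up to
    a scalar ([shift_unique]), and f_h o f_g = al(g, h) f_(gh) for a 2-cocycle
    al.  As al is a coboundary, rescaling the f_g turns them into A-linear maps
    u_g with u_h o u_g = u_(gh) ([shift_action]).

    Identifying every w in W with all the u_g w makes an A-module out of W in
    which each homogeneous component is glued to W_e: over A_e, this quotient is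
    M ([action_restricted]). *)

Set Implicit Arguments.
Unset Strict Implicit.
Unset Printing Implicit Defensive.

Import GRing.Theory.
Local Open Scope ring_scope.

(** * Well-orders *)

Section WellOrder.
Variables (T : eqType) (R : rel T) (Rwo : well_order R).

Lemma wo_min (P : T -> Prop) :
  (exists x, P x) -> exists2 z, P z & forall x, P x -> R z x.
Proof.
case=> x Px; have [|z [[zP zmin] _]] := Rwo (A := [pred y | `[< P y >]]).
  by exists x; apply/asboolP.
exists z; first exact/asboolP.
by move=> y Py; apply: zmin; apply/asboolP.
Qed.

Lemma wo_total : total R.
Proof.
move=> x y; have [|z] := @wo_min (fun u => u = x \/ u = y).
  by exists x; left.
by case=> -> zmin; rewrite zmin ?orbT //; [right | left].
Qed.

Lemma wo_refl : reflexive R.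
Proof. by move=> x; have := wo_total x x; rewrite orbb. Qed.

Lemma wo_anti : antisymmetric R.
Proof.
move=> x y; apply: (wo_chain_antisymmetric (C := predT)) => //.
exact: withinW.
Qed.

Lemma wo_trans : transitive R.
Proof.
move=> y x z xy yz.
have [|u] := @wo_min (fun u => [\/ u = x, u = y | u = z]).
  by exists x; constructor.
case=> -> umin.
- by apply: umin; constructor 3.
- suff -> : x = y by [].
  by apply: wo_anti; rewrite xy umin //; constructor.
- suff <- : y = z by [].
  by apply: wo_anti; rewrite yz umin //; constructor.
Qed.

End WellOrder.

(** * Independent families and spanning sets in any dimension *)

Section Span.
Variables (F : fieldType) (V : lmodType F).
Implicit Types (P Q : V -> Prop) (u v x : V).

Inductive span P : V -> Prop :=
| Span0 : span P 0
| SpanZD a x v : P x -> span P v -> span P (a *: x + v).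

Lemma span_sub P Q v : (forall x, P x -> Q x) -> span P v -> span Q v.
Proof.
move=> sPQ; elim=> {v} [|a x v /sPQ Qx _ Qv]; first exact: Span0.
exact: SpanZD.
Qed.

Lemma spanD P u v : span P u -> span P v -> span P (u + v).
Proof.
elim=> {u} [|a x u Px _ IH] Pv; first by rewrite add0r.
by rewrite -addrA; apply: SpanZD => //; apply: IH.
Qed.

Lemma spanZ P a v : span P v -> span P (a *: v).
Proof.
elim=> {v} [|b x v Px _ IH]; first by rewrite scaler0; exact: Span0.
by rewrite scalerDr scalerA; exact: SpanZD.
Qed.

Lemma span_gen P x : P x -> span P x.
Proof.
move=> Px; rewrite -[x]scale1r -[_ *: _]addr0.
by apply: SpanZD => //; exact: Span0.
Qed.

Lemma span_adjoin P b v :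
  span (fun x => P x \/ x = b) v -> exists c v', v = c *: b + v' /\ span P v'.
Proof.
elim=> {v} [|a x v Px _ [c [v' [-> Pv']]]].
  by exists 0, 0; rewrite scale0r addr0; split=> //; exact: Span0.
case: Px => [Px|->].
  by exists c, (a *: x + v'); rewrite addrCA; split=> //; exact: SpanZD.
by exists (a + c), v'; rewrite addrA scalerDl.
Qed.

Lemma span_sum P (I : eqType) (s : seq I) (c : I -> F) (f : I -> V) :
  {in s, forall i, P (f i)} -> span P (\sum_(i <- s) c i *: f i).
Proof.
elim: s => [|i s IH] sP; first by rewrite big_nil; exact: Span0.
rewrite big_cons; apply: SpanZD; first by apply: sP; rewrite mem_head.
by apply: IH => j js; apply: sP; rewrite in_cons js orbT.
Qed.

(** Combinations are finite, so a nonzero vector of the span has a greatest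
    generator among those that a given expression uses. *)
Lemma span_max (R : rel V) (Rwo : well_order R) P v : span P v ->
  v = 0 \/ exists2 b, P b & span (fun x => P x /\ R x b) v.
Proof.
elim=> {v} [|a x v Px _ IH]; first by left.
right; case: IH => [->|[b Pb bv]].
  by exists x => //; apply: SpanZD (Span0 _); split=> //; exact: wo_refl.
have [xb|bx] := orP (wo_total Rwo x b).
  by exists b => //; apply: SpanZD.
exists x => //; apply: SpanZD; first by split=> //; exact: wo_refl.
by apply: span_sub bv => y [Py yb]; split=> //; exact: (wo_trans Rwo yb).
Qed.

Definition independent (I : Type) (f : I -> V) : Prop :=
  forall i, ~ span (fun x => exists2 j, j <> i & x = f j) (f i).

(** Gaussian elimination along well-orders, which needs no cardinal arithmetic:
    g i is the least possible leading element of f i modulo the span of the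
    earlier f j.  If g i = g j with i before j, then subtracting a multiple of
    the reduced f i from the reduced f j would lower the leading element of the
    latter, against the minimality of g j. *)
Lemma independent_inj_spanning (I : eqType) (f : I -> V) (B : V -> Prop) :
    (forall v, span B v) -> independent f ->
  exists2 g : I -> V, injective g & forall i, B (g i).
Proof.
move=> spB indf.
have [R Rwo] := well_ordering_principle V.
have [S Swo] := well_ordering_principle I.
pose earlier i x := exists2 j, S j i /\ j <> i & x = f j.
pose upto b x := B x /\ R x b.
pose below b x := [/\ B x, R x b & x <> b].
have ne0 i w : span (earlier i) w -> f i + w <> 0.
  move=> iw /eqP; rewrite addr_eq0 => /eqP fE; apply: (indf i).
  rewrite fE -scaleN1r; apply: spanZ.
  by apply: span_sub iw => x [j [_ ji] ->]; exists j.
pose E i b := B b /\ exists2 w, span (earlier i) w & span (upto b) (f i + w).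
have /choice[g gP] : forall i, exists b, E i b /\ forall b', E i b' -> R b b'.
  move=> i; have [|b Eb bmin] := wo_min Rwo (P := E i); last by exists b.
  have [/ne0[]|[b Bb bf]] := span_max Rwo (spB (f i + 0)); first exact: Span0.
  by exists b; split=> //; exists 0 => //; exact: Span0.
exists g; last by move=> i; have [[]] := gP i.
have not_below i w : span (earlier i) w -> ~ span (below (g i)) (f i + w).
  move=> iw /(span_max Rwo)[/ne0[]//|[b [Bb bg ne] sp]].
  apply: ne; apply: (wo_anti Rwo); rewrite bg (gP i).2 //; split=> //.
  by exists w => //; apply: span_sub sp => x [[Bx _ _] xb].
have leading b v : span (upto b) v ->
    exists c v', v = c *: b + v' /\ span (below b) v'.
  move=> sp; apply: span_adjoin; apply: span_sub sp => x [Bx xb].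
  by have [->|/eqP ne] := eqVneq x b; [right | left].
have before_neq i j : S i j -> i <> j -> g i <> g j.
  move=> Sij ij gij; have [[_ [wi iwi spi]] _] := gP i.
  have [[_ [wj jwj spj]] _] := gP j.
  have [c [x [xE spx]]] := leading _ _ spi.
  have [d [y [yE spy]]] := leading _ _ spj.
  have [c0|c0] := eqVneq c 0.
    by apply: (not_below i wi) => //; rewrite xE c0 scale0r add0r.
  apply: (not_below j (wj + (- (d / c)) *: (f i + wi))).
    apply: spanD => //; apply: spanZ; apply: spanD.
      by apply: span_gen; exists i.
    apply: span_sub iwi => z [k [Ski ki] ->]; exists k => //; split.
      exact: (wo_trans Swo) Sij.
    by move=> kj; apply: ki; apply: (wo_anti Swo); rewrite Ski kj Sij.
  rewrite addrA yE xE gij scalerDr scalerA mulNr divfK // scaleNr addrACA subrr.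
  by rewrite add0r; apply: spanD => //; apply: spanZ; rewrite -gij.
move=> i j gij; apply/eqP; apply/negPn/negP => /eqP ij.
have [Sij|Sji] := orP (wo_total Swo i j); first exact: before_neq gij.
by apply: before_neq (esym gij) => //; exact: nesym.
Qed.

Lemma basis_span (B : set V) : is_basis B -> forall v, span B v.
Proof.
case=> _ gen v; have [s [c [sB ->]]] := gen v.
by apply: span_sum => b /sB /set_mem.
Qed.

Lemma independent_card_le (I : eqType) (f : I -> V) (B : set V) :
  is_basis B -> independent f -> ([set: I] #<= B)%card.
Proof.
move=> /basis_span spB /(independent_inj_spanning spB)[g ginj gB].
apply: (card_le_trans (B := range g)); last first.
  by apply: subset_card_le => _ [i _ <-].
have : (range g #= [set: I])%card by apply: inj_card_eq => x y _ _ /ginj.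
by move/card_eqPle => [].
Qed.

End Span.

(** * The F[X]-module defined by an endomorphism *)

Section PolyModule.
Variables (F : fieldType) (V : lmodType F) (th : {linear V -> V}).

Lemma iter_linearD i (u v : V) : iter i th (u + v) = iter i th u + iter i th v.
Proof. by elim: i => //= i ->; rewrite linearD. Qed.

Lemma iter_linearZ i c (v : V) : iter i th (c *: v) = c *: iter i th v.
Proof. by elim: i => //= i ->; rewrite linearZZ. Qed.

Lemma iter_linear0 i : iter i th (0 : V) = 0.
Proof. by elim: i => //= i ->; rewrite linear0. Qed.

Definition polymod of {linear V -> V} : Type := V.
Local Notation W := (polymod th).
Implicit Types (p q : {poly F}).

HB.instance Definition _ := GRing.Zmodule.on W.

Definition poly_act p (v : W) : W := \sum_(i < size p) p`_i *: iter i th v.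

Lemma poly_actE n p v :
  (size p <= n)%N -> poly_act p v = \sum_(i < n) p`_i *: iter i th v.
Proof.
move=> pn.
rewrite /poly_act (big_ord_widen n (fun i => p`_i *: iter i th v)) //.
rewrite big_mkcond; apply: eq_bigr => i _; case: ltnP => // /leq_sizeP -> //.
by rewrite scale0r.
Qed.

Lemma poly_actDl v : {morph poly_act^~ v : p q / p + q}.
Proof.
move=> p q; have pq := size_polyD p q.
rewrite !(@poly_actE (maxn (size p) (size q))) ?leq_maxl ?leq_maxr //.
by rewrite -big_split; apply: eq_bigr => i _; rewrite coefD scalerDl.
Qed.

Lemma poly_actDr : right_distributive poly_act +%R.
Proof.
move=> p u v; rewrite -big_split; apply: eq_bigr => i _.
by rewrite iter_linearD scalerDr.
Qed.

Lemma poly_actC c v : poly_act c%:P v = c *: (v : V).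
Proof. by rewrite (@poly_actE 1) ?size_polyC ?leq_b1 // big_ord1 coefC. Qed.

Lemma poly_actMX p v : poly_act (p * 'X) v = poly_act p (th v).
Proof.
rewrite (@poly_actE (size p).+1); last first.
  by rewrite (leq_trans (size_polyMleq _ _)) // size_polyX addn2.
rewrite big_ord_recl coefMX scale0r add0r; apply: eq_bigr => i _.
by rewrite coefMX /= -iterSr.
Qed.

Lemma poly_actMC p c v : poly_act (p * c%:P) v = poly_act p (c *: (v : V)).
Proof.
rewrite (@poly_actE (size p)); last first.
  by rewrite mulrC mul_polyC size_scale_leq.
apply: eq_bigr => i _; rewrite coefMC -scalerA; congr (_ *: _).
exact/esym/iter_linearZ.
Qed.

Lemma poly_actA p q v : poly_act p (poly_act q v) = poly_act (p * q) v.
Proof.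
elim/poly_ind: q p v => [|q c IH] p v.
  rewrite mulr0 /poly_act size_poly0 !big_ord0; apply: big1 => i _.
  by rewrite iter_linear0 scaler0.
rewrite poly_actDl poly_actMX poly_actC poly_actDr IH.
by rewrite mulrDr mulrA poly_actDl poly_actMX poly_actMC.
Qed.

Lemma poly_act1 : left_id 1 poly_act.
Proof. by move=> v; rewrite -[1]/(1%:P) poly_actC scale1r. Qed.

HB.instance Definition _ := GRing.Zmodule_isLmodule.Build {poly F} W
  poly_actA poly_act1 poly_actDr poly_actDl.

Lemma polymod_scaleX (v : W) : 'X *: v = th v.
Proof. by rewrite -[LHS]/(poly_act _ _) -['X]mul1r poly_actMX poly_act1. Qed.

Lemma polymod_scaleC c (v : W) : c%:P *: v = c *: (v : V) :> V.
Proof. exact: poly_actC. Qed.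

Lemma polymod_scaleXsubC c (v : W) : ('X - c%:P) *: v = th v - c *: (v : V).
Proof. by rewrite scalerBl polymod_scaleX polymod_scaleC. Qed.

End PolyModule.

(** * Schur's lemma in dimension smaller than the field *)

Section Resolvent.
Variables (F : closedFieldType) (V : lmodType F) (th : {linear V -> V}).
Hypothesis th_eigen0 : forall c v, th v = c *: v -> v = 0.
Local Notation W := (polymod th).

(** Over an algebraically closed field every p <> 0 is a product of linear
    factors, which act injectively as th has no eigenvector. *)
Lemma polymod_torsion_free (p : {poly F}) (v : W) :
  p != 0 -> p *: v = 0 -> v = 0.
Proof.
move=> p0; have [s pE] := closed_field_poly_normal p.
have inj (u : W) : (\prod_(z <- s) ('X - z%:P)) *: u = 0 -> u = 0.
  elim: s {pE} u => [|z s IH] u; first by rewrite big_nil scale1r.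
  rewrite big_cons mulrC -scalerA => /IH.
  rewrite polymod_scaleXsubC => /eqP; rewrite subr_eq0 => /eqP.
  exact: th_eigen0.
rewrite pE -mul_polyC -scalerA; set u := _ *: v => lu0; apply: inj.
move: lu0; rewrite -/u polymod_scaleC => /eqP.
by rewrite scaler_eq0 lead_coef_eq0 (negbTE p0) => /eqP.
Qed.

(** If f c is a combination of the f d with d <> c, then clearing denominators
    gives q (f c) = r m with q c <> 0, so that q - (X - c) r, which is not zero
    at c, kills m. *)
Lemma resolvent_independent (m : V) (f : F -> V) :
  m <> 0 -> (forall c, th (f c) - c *: f c = m) -> independent f.
Proof.
move=> m0 fE c spc.
have [q [r [qc qr]]] : exists q r : {poly F},
    q.[c] != 0 /\ q *: (f c : W) = r *: (m : W).
  elim: spc => [|a x v [d dc ->] _ [q [r [qc qr]]]].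
    by exists 1, 0; rewrite hornerC oner_eq0 scaler0 scale0r.
  exists (q * ('X - d%:P)), (q * a%:P + r * ('X - d%:P)); split.
    by rewrite hornerM hornerXsubC mulf_neq0 // subr_eq0; apply/eqP/nesym.
  have dE : ('X - d%:P) *: (f d : W) = m by rewrite polymod_scaleXsubC fE.
  have -> : a *: f d = a%:P *: (f d : W) by rewrite polymod_scaleC.
  rewrite scalerDr scalerDl; congr (_ + _).
    by rewrite -!scalerA -dE !scalerA -!mulrA [a%:P * _]mulrC.
  by rewrite ![_ * ('X - _)]mulrC -!scalerA qr.
have : (q - ('X - c%:P) * r) *: (m : W) = 0.
  rewrite scalerBl -scalerA -qr scalerA mulrC -scalerA polymod_scaleXsubC fE.
  exact: subrr.
move/polymod_torsion_free => /(_ _)/m0; apply.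
apply/eqP => /(congr1 (fun p => p.[c])).
rewrite hornerD hornerN hornerM hornerXsubC subrr mul0r oppr0 addr0 horner0.
by move/eqP; rewrite (negbTE qc).
Qed.

End Resolvent.

Lemma inj_surj_bijective (T U : Type) (f : T -> U) :
  injective f -> (forall y, exists x, f x = y) -> bijective f.
Proof. by move=> finj /choice[g gK]; exists g => // x; apply: finj. Qed.

Lemma simple_endo_bijective (R : pzRingType) (M : lmodType R)
    (th : {linear M -> M}) :
  simple_module M -> (forall v, th v = 0) \/ bijective th.
Proof.
case=> _ simM; have [th0|/existsNP[m thm]] := pselect (forall v, th v = 0).
  by left.
right; apply: inj_surj_bijective.
  have [|K0|KT] := simM [pred v | th v == 0].
  - split; first by rewrite inE linear0.
    move=> a u v; rewrite !inE => /eqP u0 /eqP v0.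
    by rewrite linearP u0 v0 scaler0 addr0.
  - move=> u v uv; have := K0 (u - v).
    by rewrite !inE linearB uv subrr eqxx => /esym; rewrite subr_eq0 => /eqP.
  - by case: thm; apply/eqP; have := KT m; rewrite !inE.
have [|K0|KT] := simM [pred v | `[< exists u, th u = v >]].
- split; first by apply/asboolP; exists 0; rewrite linear0.
  move=> a _ _ /asboolP[u <-] /asboolP[v <-].
  by apply/asboolP; exists (a *: u + v); rewrite linearP.
- case: thm; apply/eqP; rewrite -[_ == 0]/(th m \in pred1 0) -K0.
  by apply/asboolP; exists m.
- by move=> y; have /asboolP := KT y.
Qed.

Lemma schur_scalar (F : closedFieldType) (R : algType F) (M : lmodType R)
    (simM : simple_module M) (dimM : dim_lt_card (underlying_vect M))
    (th : {linear M -> M}) :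
  exists c : F, forall m, th m = c%:A *: m.
Proof.
case: dimM => B basisB [_ nFB]; case: (simM) => -[m m0] _.
apply: contrapT => /forallNP th_nsc.
have bij c : bijective (fun v => th v - c%:A *: v).
  pose d v := th v - c%:A *: v.
  have d_lin : linear d.
    move=> a u v; rewrite /d linearP scalerDr scalerBr opprD addrACA.
    congr (_ - _ + _).
    by rewrite !scalerA -scalerAl -scalerAr mul1r mulr1.
  pose dL := GRing.isLinear.Build R M M *:%R d d_lin.
  have [d0|//] :=
    simple_endo_bijective (HB.pack_for {linear M -> M} d dL) simM.
  case: (th_nsc c) => v; apply/eqP; rewrite -subr_eq0.
  exact/eqP/d0.
have /choice[f fE] : forall c : F, exists v : underlying_vect M,
    th v - c%:A *: (v : M) = m.
  by move=> c; have [h _ hK] := bij c; exists (h m); rewrite hK.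
pose thF : underlying_vect M -> underlying_vect M := th.
have thF_lin : linear thF by move=> c u v; exact: linearP.
pose thL := GRing.isLinear.Build F _ (underlying_vect M) *:%R thF thF_lin.
pose thV := HB.pack_for {linear underlying_vect M -> underlying_vect M} thF thL.
apply: nFB; apply: independent_card_le basisB (_ : independent f).
apply: (resolvent_independent (th := thV)) m0 fE => c v cE.
by apply: (bij_inj (bij c)); rewrite [th v]cE linear0 scaler0 !subrr.
Qed.

(** * Maps out of a direct sum *)

Section DirectSumMaps.
Variables (I : eqType) (V : zmodType) (P : I -> {pred V}) (D : direct_sum P).

Lemma direct_sum_ind (Q : V -> Prop) :
    (forall x y, Q x -> Q y -> Q (x + y)) -> Q 0 ->
    (forall i v, v \in P i -> Q v) ->
  forall v, Q v.
Proof.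
move=> QD Q0 QP v; have [s _ ->] := hcomp_supp D v.
by elim/big_ind: _ => // i _; apply: QP (hcomp_in D i v).
Qed.

Lemma eq_sum_support (U : zmodType) (s t : seq I) (f : I -> U) :
    uniq s -> uniq t ->
    (forall i, i \notin s -> f i = 0) -> (forall i, i \notin t -> f i = 0) ->
  \sum_(i <- s) f i = \sum_(i <- t) f i.
Proof.
move=> us ut s0 t0.
rewrite (bigID (mem t)) /= [X in _ + X]big1 ?addr0; last by move=> i; exact: t0.
rewrite [RHS](bigID (mem s)) /= [X in _ = _ + X]big1 ?addr0; last first.
  by move=> i; exact: s0.
rewrite -[LHS]big_filter -[RHS]big_filter; apply: perm_big; apply: uniq_perm.
- exact: filter_uniq.
- exact: filter_uniq.
- by move=> i; rewrite !mem_filter andbC.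
Qed.

Lemma direct_sum_additive (U : zmodType) (phi : I -> V -> U) :
    (forall i, {morph phi i : x y / x + y}) ->
  exists2 tau : V -> U, {morph tau : x y / x + y} &
    forall i v, v \in P i -> tau v = phi i v.
Proof.
move=> phiD; have phi0 i : phi i 0 = 0.
  by apply: (addrI (phi i 0)); rewrite -phiD !addr0.
have /choice[supp suppP] : forall v, exists s, uniq s /\
    forall i, i \notin s -> hcomp D i v = 0.
  move=> v; have [s us vE] := hcomp_supp D v; exists s; split=> // i /negbTE si.
  by rewrite (hcomp_uniq D us (fun i => hcomp_in D i v) vE) si.
pose tau v := \sum_(i <- supp v) phi i (hcomp D i v).
have tauE v s : uniq s -> (forall i, i \notin s -> hcomp D i v = 0) ->
    tau v = \sum_(i <- s) phi i (hcomp D i v).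
  move=> us s0; have [uv v0] := suppP v.
  by apply: eq_sum_support => // i => [/v0|/s0] ->.
exists tau => [x y|i v vi].
  pose s := undup (supp x ++ supp y); have us : uniq s by exact: undup_uniq.
  have [[_ x0] [_ y0]] := (suppP x, suppP y).
  have sx0 i : i \notin s -> hcomp D i x = 0.
    by rewrite mem_undup mem_cat => /norP[/x0].
  have sy0 i : i \notin s -> hcomp D i y = 0.
    by rewrite mem_undup mem_cat => /norP[_ /y0].
  rewrite !(tauE _ s) -?big_split //=.
    by apply: eq_bigr => i _; rewrite hcompD phiD.
  by move=> i si; rewrite hcompD sx0 ?sy0 ?addr0.
rewrite (tauE _ [:: i]) // ?big_seq1 ?(hcomp_hom D _ vi) ?eqxx // => j.
by rewrite inE (hcomp_hom D _ vi) => /negbTE->.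
Qed.

End DirectSumMaps.

(** * Isomorphisms of a graded module with its suspensions *)

Lemma linear_bij_inv (R : pzRingType) (U V : lmodType R) (f : {linear U -> V}) :
  bijective f -> exists g : {linear V -> U}, cancel f g /\ cancel g f.
Proof.
case=> g fK gK.
pose gL := GRing.isLinear.Build R V U *:%R g (can2_linear fK gK).
by exists (HB.pack_for {linear V -> U} g gL).
Qed.

Section GradedModule.
Variables (F : fieldType) (G : groupType) (A : algType F) (Gr : grading G A).
Variable W : gradedMod Gr.
Implicit Types (f : {linear W -> W}) (c d : F).

Lemma alg_scaleC (a : A) c (w : W) : a *: (c%:A *: w) = c%:A *: (a *: w).
Proof. by rewrite !scalerA -scalerAl -scalerAr mul1r mulr1. Qed.

Lemma alg_scaleM c d (w : W) : c%:A *: (d%:A *: w) = (c * d)%:A *: w.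
Proof. by rewrite scalerA -scalerAl mul1r scalerA. Qed.

Lemma linear_algZ f c w : f (c%:A *: w) = c%:A *: f w.
Proof. by rewrite linearZZ. Qed.

Lemma alg_scale_eq0 c (w : W) : c%:A *: w = 0 -> w <> 0 -> c = 0.
Proof.
move=> cw0 w0; apply/eqP/negPn/negP => c0; apply: w0.
by rewrite -[w]scale1r -[1]scale1r -(mulVf c0) -alg_scaleM cw0 scaler0.
Qed.

Lemma alg_scale_inj c d (w : W) : w <> 0 -> c%:A *: w = d%:A *: w -> c = d.
Proof.
move=> w0 /eqP; rewrite -subr_eq0 -scalerBl -scalerBl => /eqP.
by move/alg_scale_eq0 => cd; apply/eqP; rewrite -subr_eq0; apply/eqP/cd.
Qed.

(** The isomorphisms of W with its suspension by g, seen as maps from W to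
    itself so that they can be composed for different g. *)
Definition shift (g : G) (f : W -> W) : Prop :=
  bijective f /\ forall k w, w \in gpiece W k -> f w \in gpiece W (k * g)%g.

Lemma shift_reflect g f k w :
  shift g f -> f w \in gpiece W (k * g)%g -> w \in gpiece W k.
Proof.
move=> [fbij fP] fw; pose D := gpiece_direct W.
have fc j v : hcomp D (j * g)%g (f v) = f (hcomp D j v).
  elim/(direct_sum_ind D): v => [x y xE yE||i v vi].
  - by rewrite linearD !hcompD xE yE linearD.
  - by rewrite linear0 !(hcomp_hom D _ (piece0 D 1%g)) !if_same linear0.
  - rewrite (hcomp_hom D _ vi) (hcomp_hom D _ (fP _ _ vi)) (inj_eq (mulIg g)).
    by case: ifP; rewrite ?linear0.
suff -> : w = hcomp D k w by exact: hcomp_in.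
by apply: (bij_inj fbij); rewrite -fc (hcomp_hom D _ fw) eqxx.
Qed.

(* What the argument uses of the reduced tensor product W of A and M. *)
Variables (M : lmodType (idcomp Gr)).
Variable iota : {linear M -> restriction W (idincl Gr)}.
Hypothesis iota_inj : injective iota.
Hypothesis iota_im : forall w : W, w \in gpiece W 1%g <-> exists m, iota m = w.
Hypothesis iota_gen : forall w : W, exists t : seq (A * M),
  w = \sum_(p <- t) p.1 *: (iota p.2 : W).

Section ScalarEndomorphisms.
Hypothesis endoM :
  forall th : {linear M -> M}, exists c, forall m, th m = c%:A *: m.
Hypothesis M0 : exists m : M, m <> 0.

Lemma degree0_scalar f :
    (forall k w, w \in gpiece W k -> f w \in gpiece W k) ->
  exists c, forall w, f w = c%:A *: w.
Proof.
move=> fP; have /choice[th thE] : forall m, exists n, iota n = f (iota m).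
  by move=> m; apply/iota_im/fP/iota_im; exists m.
have th_lin : linear th.
  move=> a u v; apply: iota_inj; rewrite linearP !thE linearP.
  by rewrite [f _]linearP.
pose thL := GRing.isLinear.Build _ M M *:%R th th_lin.
have [c cE] := endoM (HB.pack_for {linear M -> M} th thL).
have iotaZ m : iota (c%:A *: m) = c%:A *: (iota m : W) by rewrite linearZZ.
exists c => w; have [t ->] := iota_gen w.
rewrite linear_sum scaler_sumr; apply: eq_bigr => p _.
by rewrite linearZZ -thE [th _]cE iotaZ alg_scaleC.
Qed.

Lemma shift_unique g f f' : shift g f -> shift g f' ->
  exists2 c, c != 0 & forall w, f w = c%:A *: f' w.
Proof.
move=> [fbij fP] f'S; have [f'bij _] := f'S.
have [h [f'K hK]] := linear_bij_inv f'bij.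
have [] := @degree0_scalar (h \o f : {linear W -> W}).
  by move=> k w wk; apply: (shift_reflect f'S); rewrite /= hK fP.
move=> c cE; have fE w : f w = c%:A *: f' w by rewrite -linear_algZ -cE /= hK.
exists c => //; apply/eqP => c0; have [m []] := M0.
apply: iota_inj; apply: (bij_inj fbij).
by rewrite !fE c0 !scale0r.
Qed.

Lemma shift_action :
    H2_trivial G F -> (forall g, exists f, shift g f) ->
  exists u : G -> {linear W -> W},
    [/\ forall g k w, w \in gpiece W k -> u g w \in gpiece W (k * g)%g,
        forall w, u 1%g w = w &
        forall g h w, u h (u g w) = u (g * h)%g w].
Proof.
move=> H2 /choice[f fS].
have comp g h : shift (g * h)%g (f h \o f g).
  have [[gb gP] [hb hP]] := (fS g, fS h); split; first exact: bij_comp.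
  by move=> k w wk; rewrite mulgA; apply/hP/gP.
have /choice[al alP] : forall p : G * G, exists c, c != 0 /\
    forall w, f p.2 (f p.1 w) = c%:A *: f (p.1 * p.2)%g w.
  case=> g h.
  have [c c0 cE] := shift_unique (f := f h \o f g) (comp g h) (fS _).
  by exists c.
have al0 g h : al (g, h) != 0 by case: (alP (g, h)).
have alE g h w : f h (f g w) = (al (g, h))%:A *: f (g * h)%g w.
  by case: (alP (g, h)) => _; apply.
have f_neq0 g : exists w : W, f g w <> 0.
  have [[fb _] [m m0]] := (fS g, M0); exists (iota m) => fm; apply: m0.
  by apply: iota_inj; apply: (bij_inj fb); rewrite fm !linear0.
have [|l l0 lE] := H2 (fun g h => al (g, h)).
  (* The cocycle identity compares the two ways to rewrite f k (f h (f g w)). *)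
  split=> // g h k; have [w w0] := f_neq0 (g * h * k)%g.
  apply: (alg_scale_inj w0); rewrite -!alg_scaleM -alE -linear_algZ -alE.
  by rewrite alE [f (h * k)%g _]alE alg_scaleM mulrC -alg_scaleM mulgA.
pose u g w := (l g)^-1%:A *: f g w.
have u_lin g : linear (u g).
  by move=> a v w; rewrite /u linearP scalerDr alg_scaleC.
pose uL g := GRing.isLinear.Build A W W *:%R (u g) (u_lin g).
have uM g h w : u h (u g w) = u (g * h)%g w.
  rewrite /u linear_algZ alE lE !alg_scaleM; congr (_%:A *: _).
  by rewrite !mulrA divfK ?mulVf ?mul1r.
exists (fun g => HB.pack_for {linear W -> W} (u g) (uL g)); split=> //.
- move=> g k w wk; have [_ /(_ k w wk) fP] := fS g.
  have [a0 aD] := apiece_submod Gr 1%g.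
  rewrite -[(k * g)%g]mul1g; apply: gpieceZ fP.
  by rewrite -[_%:A]addr0; apply: aD => //; exact: apiece1.
- (* u 1 is injective and idempotent *)
  move=> w; have uinj : injective (u 1%g).
    move=> x y /(congr1 (fun w => (l 1%g)%:A *: w)).
    rewrite /u !alg_scaleM divff // !scale1r.
    by case: (fS 1%g) => /bij_inj finj _ /finj.
  by apply: uinj; rewrite [u _ (u _ _)]uM mulg1.
Qed.

End ScalarEndomorphisms.

(** The A-module is the quotient of W by the w - u_g w.  To see that it does not
    kill anything of W_e, let tau be the additive retraction of W onto W_e that
    is the inverse of u_g on W_g.  It is constant on the orbits of u; the
    quotient is taken by the largest A-submodule N in the kernel of tau, which
    contains the w - u_g w because the u_g are A-linear. *)
Lemma action_restricted (u : G -> {linear W -> W}) :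
    (forall g k w, w \in gpiece W k -> u g w \in gpiece W (k * g)%g) ->
    (forall w, u 1%g w = w) ->
    (forall g h w, u h (u g w) = u (g * h)%g w) ->
  restricted_from_alg M.
Proof.
move=> uP u1 uM; pose D := gpiece_direct W.
have [tau tauD tauP] := direct_sum_additive D (phi := fun g => u g^-1%g)
  (fun g => linearD (u g^-1%g)).
have tau0 : tau 0 = 0 by apply: (addrI (tau 0)); rewrite -tauD !addr0.
have tauB x y : tau (x - y) = tau x - tau y.
  by apply/eqP; rewrite eq_sym subr_eq -tauD subrK.
have tauu g w : tau (u g w) = tau w.
  elim/(direct_sum_ind D): w => [x y xE yE||k w wk].
  - by rewrite linearD !tauD xE yE.
  - by rewrite linear0.
  - by rewrite (tauP (k * g)%g) ?(tauP k) ?uP // uM invgM mulVKg.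
pose N : {pred W} := [pred w | `[< forall a, tau (a *: w) = 0 >]].
have subN : submod_closed N.
  split; first by apply/asboolP => a; rewrite scaler0.
  move=> b x y /asboolP xN /asboolP yN; apply/asboolP => a.
  by rewrite scalerDr scalerA tauD xN yN addr0.
have uN g w : w - u g w \in N.
  by apply/asboolP => a; rewrite scalerBr -linearZZ tauB tauu subrr.
pose f m : restriction (quotmod subN) (idincl Gr) := qproj subN (iota m).
have f_lin : linear f.
  by move=> a x y; rewrite /f linearP qprojD [qproj subN (_ *: _)]qprojZ.
pose fL := GRing.isLinear.Build _ M _ *:%R f f_lin.
exists (quotmod subN).
exists (HB.pack_for {linear M -> restriction (quotmod subN) (idincl Gr)} f fL).
apply: inj_surj_bijective => [m n /qprojP/asboolP/(_ 1)|y].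
  rewrite scale1r (tauP 1%g) ?invg1 ?u1.
    by move/eqP; rewrite subr_eq0 => /eqP/iota_inj.
  by apply/iota_im; exists (m - n); rewrite linearB.
rewrite -[y]qreprK.
elim/(direct_sum_ind D): (qrepr y) => [v w [m mE] [n nE]||k w wk].
- by exists (m + n); rewrite linearD mE nE qprojD.
- by exists 0; rewrite linear0 qproj0.
- have [|m mE] := (iota_im (u k^-1%g w)).1; first by rewrite -(mulgV k) uP.
  by exists m; apply/esym/qprojP; rewrite mE.
Qed.

End GradedModule.

(** * The identity component of the reduced tensor product *)

Section ReducedTensor.
Variables (F : fieldType) (G : groupType) (A : algType F) (Gr : grading G A).
Variable M : lmodType (idcomp Gr).

Local Notation T := (graded_tensor M).
Local Notation W := (reduced_tensor M).
Local Notation D := (apiece_direct Gr).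
Local Notation in_A := (idincl Gr).

Definition unit_tensor (m : M) : tensor in_A M := tens in_A 1 m.

Lemma unit_tensorZ (r : idcomp Gr) m :
  unit_tensor (r *: m) = val r *: unit_tensor m.
Proof. by rewrite /unit_tensor -tens_bal tensZ mul1r mulr1. Qed.

Lemma unit_tensor_linear : linear (unit_tensor : M -> restriction T in_A).
Proof.
by move=> r m n; rewrite /unit_tensor tensDr [tens _ _ (_ *: _)]unit_tensorZ.
Qed.

Lemma unit_tensor_piece m : unit_tensor m \in gpiece T 1%g.
Proof.
apply/asboolP; exists [:: (1, m)]; last by rewrite big_seq1.
by move=> p; rewrite inE => /eqP->; exact: apiece1.
Qed.

Lemma hcompMr g a (r : idcomp Gr) : hcomp D g (a * val r) = hcomp D g a * val r.
Proof.
elim/(direct_sum_ind D): a => [x y xE yE||k a ak].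
- by rewrite mulrDl !hcompD xE yE mulrDl.
- by rewrite mul0r (hcomp_hom D _ (piece0 D g)) if_same mul0r.
- have ark : a * val r \in Gr k by have := apieceM ak (valP r); rewrite mulg1.
  by rewrite (hcomp_hom D _ ark) (hcomp_hom D _ ak); case: ifP; rewrite ?mul0r.
Qed.

(** The map that sends a (x) m to a_e m, where a_e is the identity component of
    a, is a retraction. *)
Lemma unit_tensor_inj : injective unit_tensor.
Proof.
pose ae (a : A) : idcomp Gr := Sub (hcomp D 1%g a) (hcomp_in D 1%g a).
pose h (a : A) (m : M) := ae a *: m.
have hDl a b m : h (a + b) m = h a m + h b m.
  by rewrite /h -scalerDl; congr (_ *: _); apply: val_inj; rewrite /= hcompD.
have hDr a m n : h a (m + n) = h a m + h a n by rewrite /h scalerDr.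
have hb a r m : h (a * in_A r) m = h a (r *: m).
  by rewrite /h scalerA; congr (_ *: _); apply: val_inj; rewrite /= hcompMr.
apply: (can_inj (g := tensor_lift h)) => m.
rewrite (tensor_lift_tens hDl hDr hb) /h -[RHS]scale1r; congr (_ *: _).
by apply: val_inj; rewrite /= (hcomp_hom D _ (apiece1 Gr)) eqxx.
Qed.

Definition induced_unit (m : M) : restriction W in_A := qproj _ (unit_tensor m).

Lemma induced_unit_linear : linear induced_unit.
Proof.
move=> r m n.
by rewrite /induced_unit [unit_tensor _]unit_tensor_linear qprojD qprojZ.
Qed.

HB.instance Definition _ := GRing.isLinear.Build _ M (restriction W in_A) *:%R
  induced_unit induced_unit_linear.

Lemma induced_unit_inj : injective induced_unit.
Proof.
move=> m n /qprojP mn; apply: unit_tensor_inj; apply/eqP.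
rewrite -subr_eq0; apply/eqP; apply: (@radical_zero_e _ _ _ _ T) => //.
exact: (pieceB (gpiece_direct T) (unit_tensor_piece m) (unit_tensor_piece n)).
Qed.

Lemma induced_unit_im (w : W) :
  w \in gpiece W 1%g <-> exists m, induced_unit m = w.
Proof.
split=> [/asboolP[_ /asboolP[s sP ->] ->]|[m <-]]; last first.
  by apply/asboolP; exists (unit_tensor m) => //; exact: unit_tensor_piece.
elim: s sP => [|[a m] s IH] sP.
  by exists 0; rewrite big_nil linear0 qproj0.
have [|n nE] := IH; first by move=> p ps; apply: sP; rewrite in_cons ps orbT.
have a1 : a \in Gr 1%g by apply: (sP (a, m)); rewrite mem_head.
exists ((Sub a a1 : idcomp Gr) *: m + n).
rewrite linearD /= nE big_cons qprojD; congr (_ + _).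
by rewrite /induced_unit unit_tensorZ tensZ mulr1.
Qed.

Lemma induced_unit_gen (w : W) : exists t : seq (A * M),
  w = \sum_(p <- t) p.1 *: (induced_unit p.2 : W).
Proof.
exists (tpairs (qrepr w)); rewrite -{1}[w]qreprK {1}[qrepr w]tensE qproj_sum.
by apply: eq_bigr => p _; rewrite -qprojZ tensZ mulr1.
Qed.

End ReducedTensor.

Theorem corollary6p7 (F : closedFieldType) (G : groupType) (A : algType F)
    (Gr : grading G A) (HF : H2_trivial G F) (M : lmodType (idcomp Gr))
    (simpleM : simple_module M) (invM : graded_invariant M)
    (dimM : dim_lt_card (underlying_vect M)) :
  restricted_from_alg M.
Proof.
have M0 : exists m : M, m <> 0 by case: simpleM.
have shiftP g : exists f : {linear reduced_tensor M -> reduced_tensor M},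
    shift g f.
  by have [f fS] := invM g; exists f.
have iota_inj := @induced_unit_inj _ _ _ _ M.
have iota_im := @induced_unit_im _ _ _ _ M.
have [u [uP u1 uM]] := shift_action iota_inj iota_im
  (@induced_unit_gen _ _ _ _ M) (schur_scalar simpleM dimM) M0 HF shiftP.
exact: (action_restricted iota_inj iota_im uP u1 uM).
Qed.
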